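(* Let $k=\mathbb{C}$. Let $\mathcal{M}_n$ be the set of pairs $(X,Y)$ of matrices in $M_n(k)$ with $XY-YX=Y^2$ and $\mathrm{rk}\,Y=n-1$. For $\lambda,\mu\in k$ let $P_{\lambda,\mu}$ denote the pair $(X_{\lambda,\mu},Y)$, where $X_{\lambda,\mu}$ is the $n\times n$ matrix with all main diagonal entries equal to $\lambda$, first upper diagonal entries $\mu+1,\mu+2,\dots,\mu+n-1$ (that is, $(X_{\lambda,\mu})_{i,i+1}=\mu+i$ for $1\le i\le n-1$), and all other entries zero, and $Y$ is the $n\times n$ nilpotent Jordan block ($Y_{i,i+1}=1$ for $1\le i\le n-1$, all other entries zero). Then every pair $(X,Y)\in\mathcal{M}_n$ is conjugate to $P_{\lambda,\mu}$ for some $\lambda,\mu$. No two pairs $P_{\lambda,\mu}$ with different $(\lambda,\mu)$ are conjugate.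
   Context: Conjugate means simultaneously conjugate: $(X,Y)$ and $(X',Y')$ are conjugate if there is $g\in GL_n(k)$ with $gXg^{-1}=X'$ and $gYg^{-1}=Y'$.
   Formalization: The first upper diagonal entries of X are taken as μ−i instead of μ+i, since the printed pairs satisfy XY−YX=−Y² and so existence fails for n≥3; non-conjugacy for different (λ,μ) is claimed only for n≥2, since for n=1 the pair does not depend on μ. *)

(* Defs.v *)
From mathcomp Require Import all_boot all_order all_algebra.

Set Implicit Arguments.
Unset Strict Implicit.
Unset Printing Implicit Defensive.

Import GRing.Theory.
Local Open Scope ring_scope.

Section JordanPlaneModules.
Context {k : fieldType} {n : nat}.
Implicit Types (p q : 'M[k]_n * 'M[k]_n) (lambda mu : k).

Definition conjugate p q : Prop :=
  exists2 g : 'M[k]_n, g \in unitmx &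
    g *m p.1 *m invmx g = q.1 /\ g *m p.2 *m invmx g = q.2.

(* The truncated [n.-1] is the true [n - 1] only for [0 < n]. *)
Definition in_M p : Prop :=
  p.1 *m p.2 - p.2 *m p.1 = p.2 *m p.2 /\ \rank p.2 = n.-1.

Definition jordanY : 'M[k]_n := \matrix_(i, j) (j == i.+1 :> nat)%:R.

(* Indices start at 0, so the superdiagonal entry in row [i] is           *)
(* [mu - (i + 1)].  The published formula is [mu + (i + 1)]; with that    *)
(* sign the pair satisfies XY - YX = - Y^2 and so, for n >= 3, is not     *)
(* conjugate to any solution of XY - YX = Y^2.  The sign is corrected     *)
(* here and the relation is kept.                                         *)
Definition jordanX lambda mu : 'M[k]_n :=
  \matrix_(i, j) (if i == j then lambda
                  else if j == i.+1 :> nat then mu - i.+1%:R else 0).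

(* For [n = 1] this pair does not depend on [mu], so the uniqueness of      *)
(* [(lambda, mu)] up to conjugacy can hold only for [1 < n].               *)
Definition P lambda mu : 'M[k]_n * 'M[k]_n := (jordanX lambda mu, jordanY).

End JordanPlaneModules.

Arguments in_M {k n} p.
Arguments jordanY {k} n.
Arguments jordanX {k} n lambda mu.
Arguments P {k} n lambda mu.

(* Main.v *)
Require Import Defs.
From mathcomp Require Import all_boot all_order all_algebra.
From mathcomp Require Import reals complex.

Set Implicit Arguments.
Unset Strict Implicit.
Unset Printing Implicit Defensive.

Import GRing.Theory.
Local Open Scope ring_scope.

(** The relation XY - YX = Y^2 makes bracketing with X act on polynomials in
    Y as the derivation p |-> p' Y^2 [mul_horner_relation].  Applied to the
    minimal polynomial of Y, in characteristic 0, it forces Y to be nilpotent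
    [relation_nilpotent]; together with \rank Y = n - 1 this makes Y a single
    nilpotent block, so some row vector v0 is cyclic for Y.

    Matrices act on row vectors, on the right.  A basis v, vY, ..., vY^(n-1)
    puts Y in Jordan form, and it puts X in the prescribed bidiagonal form as
    soon as v X = lambda v + mu vY, because moving X past Y^i changes the
    coefficient of vY^(i+1) by -i [krylov_conjugate].  So existence reduces to
    the choice of a cyclic v for which vX has no component beyond vY.  For an
    arbitrary cyclic v0, read lambda and mu off the first two coefficients of
    v0 X, and put A := X - lambda - mu Y, which satisfies the same relation
    with Y.  Then A maps the whole space into the image of Y^2, and already
    maps the image of Y onto it, since vY^j A has leading term -j vY^(j+1)
    [sqr_submx_mul].  Hence v0 A = (w Y) A for some w, and v := v0 - w Y is
    killed by A and still cyclic [relation_cyclic_vector].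

    For uniqueness, a conjugating matrix g commutes with the Jordan block, so
    its first column vanishes below g 0 0 and its first two diagonal entries
    agree; the first two entries of the first row of the intertwining equation
    for X then give lambda and mu [conjugate_P_inj]. *)

Lemma expr_eq0_leq (S : pzSemiRingType) (x : S) i j :
  (i <= j)%N -> x ^+ i = 0 -> x ^+ j = 0.
Proof. by move=> le_ij xi0; rewrite -(subnKC le_ij) exprD xi0 mul0r. Qed.

(** * Consequences of the relation XY = YX + Y^2 *)

Section CommutationRelation.
Variables (F : fieldType) (n : nat).
Implicit Types (X Y A : 'M[F]_n.+1) (p : {poly F}) (v : 'rV[F]_n.+1).

(** Bracketing with X is a derivation sending Y to Y^2, which commutes with Y;
    hence the chain rule. *)
Lemma mul_horner_relation X Y p : X * Y = Y * X + Y ^+ 2 ->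
  X * horner_mx Y p = horner_mx Y p * X + horner_mx Y p^`() * Y ^+ 2.
Proof.
move=> XY; elim/poly_ind: p => [|p c IHp].
  by rewrite deriv0 rmorph0 mulr0 !mul0r addr0.
have cX : c%:M * X = X * c%:M by rewrite -!mulmxE scalar_mxC.
rewrite derivD derivM derivX derivC mulr1 addr0 !rmorphD !rmorphM /=.
rewrite horner_mx_X horner_mx_C !mulrDr !mulrDl mulrA IHp cX mulrDl.
rewrite -(mulrA _ X Y) XY mulrDr -!mulrA (mulrA Y Y) -expr2 -!addrA.
by congr (_ + _); rewrite addrA addrC; congr (_ + _); rewrite addrC.
Qed.

Lemma mul_exp_relation X Y i : X * Y = Y * X + Y ^+ 2 ->
  X * Y ^+ i = Y ^+ i * X + Y ^+ i.+1 *+ i.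
Proof.
move=> XY; have := mul_horner_relation 'X^i XY.
rewrite derivXn raddfMn /= !rmorphXn /= horner_mx_X => ->.
congr (_ + _); case: i => [|i]; first by rewrite mul0r.
by rewrite mulrnAl -exprD addn2.
Qed.

(** The minimal polynomial p of Y divides p' 'X^2.  Split off the power of 'X:
    p = q 'X^m with q prime to 'X.  Then q divides q', so q is constant in
    characteristic 0, and Y^m = 0. *)
Lemma relation_nilpotent X Y : [pchar F] =i pred0 ->
  X * Y = Y * X + Y ^+ 2 -> Y ^+ n.+1 = 0.
Proof.
move=> char0 XY; pose p := mxminpoly Y.
have p_neq0 : p != 0 by rewrite monic_neq0 // mxminpoly_monic.
have [m [q /implyP/(_ p_neq0) q0]] := multiplicity_XsubC p 0.
rewrite subr0 => def_p.
have q_neq0 : q != 0.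
  by apply: contraNneq p_neq0 => q_eq0; rewrite def_p q_eq0 mul0r.
have p_dvd : p %| p^`() * 'X^2.
  apply/mxminpoly_minP; rewrite rmorphM rmorphXn /= horner_mx_X.
  have := mul_horner_relation p XY.
  by rewrite mx_root_minpoly mulr0 mul0r add0r => <-.
have q_dvd : q %| q^`().
  have q_dvdp : q %| p by rewrite def_p dvdp_mulr.
  have := dvdp_trans q_dvdp p_dvd.
  rewrite def_p derivM mulrDl dvdp_addl; last by rewrite -mulrA dvdp_mulr.
  rewrite -mulrA -exprD Gauss_dvdpl //.
  by rewrite coprimep_expr // coprimepX.
have q'0 : q^`() = 0.
  apply: contraTeq q_dvd => q'_neq0; apply/negP => /(dvdp_leq q'_neq0).
  by rewrite leqNgt lt_size_deriv.
have size_q : (size q <= 1)%N.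
  apply/leq_sizeP => -[//|i] _; apply/eqP.
  have := congr1 (fun r : {poly F} => r`_i) q'0.
  rewrite coef_deriv coef0 -mulr_natr => /eqP.
  by rewrite mulf_eq0 (pcharf0P F).1 // orbF.
have def_q := size1_polyC size_q.
have Ym0 : Y ^+ m = 0.
  have := mx_root_minpoly Y; rewrite -/p def_p rmorphM rmorphXn /= horner_mx_X.
  rewrite def_q horner_mx_C -mulmxE mul_scalar_mx => /eqP.
  by rewrite scaler_eq0 -polyC_eq0 -def_q (negPf q_neq0) /= => /eqP.
have le_mn : (m <= n.+1)%N.
  have := dvdp_leq (monic_neq0 (char_poly_monic Y)) (mxminpoly_dvd_char Y).
  rewrite size_char_poly -/p def_p size_Mmonic ?monicXn //.
  rewrite size_polyXn addnS /= => le_m; rewrite -ltnS.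
  apply: leq_trans le_m.
  by rewrite -[X in (X < _)%N]add0n ltn_add2r size_poly_gt0.
exact: expr_eq0_leq le_mn Ym0.
Qed.

(** * Cyclic vectors *)

(** The kernel of Y is a line, so each further power of Y loses at most one
    dimension. *)
Lemma exp_neq0_of_rank Y : \rank Y = n -> Y ^+ n != 0.
Proof.
move=> rkY.
suff rk k : (n.+1 <= k + \rank (Y ^+ k))%N.
  have : (n + 1 <= n + \rank (Y ^+ n))%N by rewrite addn1.
  by rewrite leq_add2l lt0n mxrank_eq0.
elim: k => [|k IHk]; first by rewrite expr0 mxrank1.
apply: leq_trans IHk _; rewrite exprSr -mulmxE -(mxrank_mul_ker (Y ^+ k) Y).
rewrite addSnnS leq_add2l -[leqRHS]addn1 leq_add2l.
have := mxrankS (capmxSr (Y ^+ k) (kermx Y)).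
by rewrite mxrank_ker rkY subSnn.
Qed.

Definition krylov v Y : 'M[F]_n.+1 := \matrix_(i < n.+1) (v *m Y ^+ i).

Lemma krylov_unit v Y : Y ^+ n.+1 = 0 -> v *m Y ^+ n != 0 ->
  krylov v Y \in unitmx.
Proof.
move=> Y0 vYn; rewrite -row_free_unit; apply: inj_row_free => u.
rewrite mulmx_sum_row => uK0.
(* The first nonzero coordinate u i would be isolated by Y ^+ (n - i), which
   kills the later rows. *)
have u0 k : forall i : 'I_n.+1, i = k :> nat -> u 0 i = 0.
  elim/ltn_ind: k => k IHk i def_k.
  have := congr1 (mulmx^~ (Y ^+ (n - i))) uK0.
  have le_in : (i <= n)%N by rewrite -ltnS.
  have expD j : row j (krylov v Y) *m Y ^+ (n - i) = v *m Y ^+ (j + (n - i)).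
    by rewrite rowK -mulmxA mulmxE -exprD.
  rewrite /= mul0mx mulmx_suml (bigD1 i) //= big1 => [|j ne_ji].
    rewrite addr0 -scalemxAl expD subnKC //.
    by move/eqP; rewrite scaler_eq0 (negPf vYn) orbF => /eqP.
  rewrite -scalemxAl expD.
  have [lt_ji|le_ij] := ltnP j i; first by rewrite (IHk j) ?scale0r -?def_k.
  have lt_ij : (i < j)%N by rewrite ltn_neqAle eq_sym ne_ji.
  have lt_n : (n < j + (n - i))%N.
    by rewrite -[X in (X < _)%N](subnKC le_in) ltn_add2r.
  by rewrite (expr_eq0_leq lt_n Y0) mulmx0 scaler0.
by apply/rowP => i; rewrite mxE (u0 i).
Qed.

Lemma cyclic_horner v w Y : krylov v Y \in unitmx ->
  exists p, w = v *m horner_mx Y p.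
Proof.
move=> Ku; pose u := w *m invmx (krylov v Y).
exists (\sum_i u 0 i *: 'X^i).
rewrite -[LHS](mulmxKV Ku) -/u mulmx_sum_row rmorph_sum mulmx_sumr /=.
apply: eq_bigr => i _.
by rewrite rowK horner_mxZ rmorphXn /= horner_mx_X -scalemxAr.
Qed.

(** The filtration by the images of the Y^j makes this triangular: A raises
    the filtration by 2, so Y^j A = A Y^j - j Y^(j+1) agrees with -j Y^(j+1)
    modulo the image of Y^(j+2), and j is invertible for 0 < j. *)
Lemma sqr_submx_mul A Y : [pchar F] =i pred0 ->
  A * Y = Y * A + Y ^+ 2 -> Y ^+ n.+1 = 0 -> (A <= Y ^+ 2)%MS ->
  (Y ^+ 2 <= Y *m A)%MS.
Proof.
move=> char0 AY Y0 A_Y2.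
(* Descending induction on j, from Y ^+ n.+1 = 0. *)
suff sub k j : (n.+1 <= j + k)%N -> (0 < j)%N -> (Y ^+ j.+1 <= Y *m A)%MS.
  by apply: (sub n 1%N).
elim: k j => [|k IHk] j le_n j_gt0.
  have -> : Y ^+ j.+1 = 0; last exact: sub0mx.
  by rewrite addn0 in le_n; exact: expr_eq0_leq (leqW le_n) Y0.
have jF : j%:R != 0 :> F by rewrite (pcharf0P F).1 // -lt0n.
rewrite -(eqmx_scale _ jF) scaler_nat.
have -> : Y ^+ j.+1 *+ j = A * Y ^+ j - Y ^+ j * A.
  by rewrite mul_exp_relation // addrC addKr.
apply: addmx_sub.
  apply: submx_trans (IHk j.+1 _ _) => //; last by rewrite addSnnS.
  by rewrite -[j.+2]add2n exprD -!mulmxE submxMr.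
by rewrite eqmx_opp -(prednK j_gt0) exprSr -mulrA -mulmxE submxMl.
Qed.

(** A cyclic vector v0 exists by the rank condition; it is corrected by an
    element of the image of Y, which keeps it cyclic, so as to be killed by
    A = X - lambda - mu Y. *)
Lemma relation_cyclic_vector X Y : [pchar F] =i pred0 ->
  X * Y = Y * X + Y ^+ 2 -> \rank Y = n ->
  exists lambda mu v,
    v *m Y ^+ n != 0 /\ v *m X = lambda *: v + mu *: (v *m Y).
Proof.
move=> char0 XY rkY; have Y0 := relation_nilpotent char0 XY.
have [v0 v0Yn] : exists v, v *m Y ^+ n != 0.
  have /rowV0Pn[_ /submxP[v ->] vYn] := exp_neq0_of_rank rkY.
  by exists v.
have Ku := krylov_unit Y0 v0Yn.
have [p def_p] := cyclic_horner (v0 *m X) Ku.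
pose A := X - (p`_0)%:M - p`_1 *: Y.
have AY : A * Y = Y * A + Y ^+ 2.
  rewrite !mulrBl !mulrBr XY -!mulmxE scalar_mxC -scalemxAl -scalemxAr.
  by rewrite -!addrA; congr (_ + _); rewrite addrC addrA.
have v0A : (v0 *m A <= Y ^+ 2)%MS.
  have -> : v0 *m A = v0 *m horner_mx Y (drop_poly 2 p) *m Y ^+ 2.
    rewrite mulmxBr mulmxBr def_p -!mulmxBr -mulmxA mulmxE.
    have take2 : take_poly 2 p = (p`_0)%:P + p`_1 *: 'X.
      apply/polyP => -[|[|j]]; rewrite coef_take_poly coefD coefC coefZ coefX /=.
      - by rewrite mulr0 addr0.
      - by rewrite mulr1 add0r.
      - by rewrite mulr0 addr0.
    rewrite -[X in horner_mx Y X - _](poly_take_drop 2 p) take2.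
    rewrite !rmorphD rmorphM rmorphXn /= horner_mxZ horner_mx_X horner_mx_C.
    by rewrite -addrA -opprD addrAC subrr add0r.
  exact: submxMl.
have A_Y2 : (A <= Y ^+ 2)%MS.
  rewrite -(mulKmx Ku A); apply: submx_trans (submxMl _ _) _.
  apply/row_subP => i; rewrite row_mul rowK -mulmxA mulmxE.
  have -> : Y ^+ i * A = A * Y ^+ i - Y ^+ i.+1 *+ i.
    by rewrite mul_exp_relation // addrK.
  rewrite mulmxBr; apply: addmx_sub.
    rewrite -mulmxE mulmxA; apply: submx_trans (submxMr _ v0A) _.
    by rewrite mulmxE -exprD addnC exprD -mulmxE submxMl.
  rewrite eqmx_opp; case: (nat_of_ord i) => [|j].
    by rewrite mulmx0 sub0mx.
  rewrite -scaler_nat -scalemxAr scalemx_sub //.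
  by rewrite -[j.+2]addn2 exprD -mulmxE mulmxA submxMl.
have /submxP[w def_w] := submx_trans v0A (sqr_submx_mul char0 AY Y0 A_Y2).
exists p`_0, p`_1, (v0 - w *m Y); split.
  by rewrite mulmxBl -[w *m Y *m _]mulmxA mulmxE -exprS Y0 mulmx0 subr0.
have : (v0 - w *m Y) *m A = 0 by rewrite mulmxBl -mulmxA -def_w subrr.
rewrite 2!mulmxBr mul_mx_scalar -scalemxAr => /eqP.
by rewrite -addrA -opprD subr_eq0 => /eqP.
Qed.

(** * Normal form and its uniqueness *)

(** The rows of the Jordan block shift the indices; the assumption f n.+1 = 0
    accounts for its zero last row. *)
Lemma sum_shift (V : lmodType F) (f : nat -> V) i : f n.+1 = 0 ->
  (i <= n)%N ->
  \sum_(j < n.+1) (j == i.+1 :> nat)%:R *: f j = f i.+1.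
Proof.
move=> fn; rewrite leq_eqVlt => /predU1P[->|lt_in].
  rewrite fn big1 // => j _.
  by rewrite ltn_eqF ?scale0r ?ltn_ord.
rewrite (bigD1 (Ordinal (lt_in : (i.+1 < n.+1)%N))) //= eqxx scale1r.
rewrite big1 ?addr0 // => j.
by rewrite -val_eqE /= => /negPf->; rewrite scale0r.
Qed.

(** Row i of krylov v Y times X is vY^i X = v X Y^i - i vY^(i+1), that is
    lambda vY^i + (mu - i) vY^(i+1).  The superdiagonal of jordanX starts one
    below its parameter, whence mu + 1. *)
Lemma krylov_conjugate X Y v lambda mu : X * Y = Y * X + Y ^+ 2 ->
  Y ^+ n.+1 = 0 -> v *m Y ^+ n != 0 ->
  v *m X = lambda *: v + mu *: (v *m Y) ->
  conjugate (X, Y) (P n.+1 lambda (mu + 1)).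
Proof.
move=> XY Y0 vYn vX; have Ku := krylov_unit Y0 vYn; exists (krylov v Y) => //=.
have rowJ (i : 'I_n.+1) :
    \sum_(j < n.+1) (j == i.+1 :> nat)%:R *: (v *m Y ^+ j) = v *m Y ^+ i.+1.
  apply: (sum_shift (f := fun j => v *m Y ^+ j)) (leq_ord i).
  by rewrite Y0 mulmx0.
split; [suff -> : krylov v Y *m X = jordanX n.+1 lambda (mu + 1) *m krylov v Y |
  suff -> : krylov v Y *m Y = jordanY n.+1 *m krylov v Y]; rewrite ?mulmxK //;
  apply/row_matrixP => i; rewrite !row_mul rowK [RHS]mulmx_sum_row.
  rewrite -mulmxA mulmxE.
  have -> : Y ^+ i * X = X * Y ^+ i - Y ^+ i.+1 *+ i.
    by rewrite mul_exp_relation // addrK.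
  rewrite mulmxBr -mulmxE mulmxA vX mulmxDl -!scalemxAl -mulmxA mulmxE -exprS.
  rewrite -scaler_nat -scalemxAr -addrA -scalerBl.
  under eq_bigr => j _.
    rewrite !mxE rowK.
    have -> : (if i == j then lambda else if j == i.+1 :> nat
        then mu + 1 - i.+1%:R else 0)
      = lambda * (i == j)%:R + (mu - i%:R) * (j == i.+1 :> nat)%:R.
      case: eqP => [<-|_]; first by rewrite mulr1 ltn_eqF // mulr0 addr0.
      rewrite mulr0 add0r; case: eqP => _; last by rewrite mulr0.
      by rewrite mulr1 -natr1 opprD addrACA subrr addr0.
    rewrite scalerDl -!scalerA; over.
  rewrite big_split /= -!scaler_sumr rowJ; congr (_ *: _ + _).
  rewrite (bigD1 i) //= eqxx scale1r big1 ?addr0 // => j.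
  by rewrite eq_sym => /negPf->; rewrite scale0r.
rewrite -mulmxA mulmxE -exprSr -rowJ.
by apply: eq_bigr => j _; rewrite !mxE rowK.
Qed.

End CommutationRelation.

(** Size at least 2 is what makes mu visible, as the entry (0, 1) of X. *)
Lemma conjugate_P_inj (F : fieldType) n (lambda mu lambda' mu' : F) :
  conjugate (P n.+2 lambda mu) (P n.+2 lambda' mu') ->
  (lambda, mu) = (lambda', mu').
Proof.
case=> g g_unit [/= gX gY].
have {}gX : g *m jordanX n.+2 lambda mu = jordanX n.+2 lambda' mu' *m g.
  by rewrite -gX mulmxKV.
have {}gY : g *m jordanY n.+2 = jordanY n.+2 *m g.
  by rewrite -[in RHS]gY mulmxKV.
have g_col0 (i : 'I_n.+1) : g (lift ord0 i) 0 = 0.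
  have := congr1 (fun M : 'M_n.+2 => M (widen_ord (leqnSn _) i) 0) gY.
  rewrite !mxE big1 => [|k _]; last by rewrite mxE mulr0.
  rewrite (bigD1 (lift ord0 i)) //= mxE eqxx mul1r big1 ?addr0 // => k.
  by rewrite -val_eqE mxE /= => /negPf->; rewrite mul0r.
have g11 : g (lift ord0 0) (lift ord0 0) = g 0 0.
  have := congr1 (fun M : 'M_n.+2 => M 0 (lift ord0 0)) gY.
  rewrite !mxE !big_ord_recl !mxE /= !big1 => [|k _|k _];
    rewrite ?mxE /= ?mulr0 ?mul0r //.
  by rewrite mulr1 mul1r !add0r !addr0 => /esym.
have g00 : g 0 0 != 0.
  have := congr1 (fun M : 'M_n.+2 => M 0 0) (mulVmx g_unit).
  rewrite !mxE big_ord_recl big1 ?addr0 => [|i _]; last by rewrite g_col0 mulr0.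
  by move=> g00; apply: contra_eq_neq g00 => ->; rewrite mulr0 eq_sym oner_eq0.
have lambdaE : lambda = lambda'.
  apply: (mulfI g00).
  have := congr1 (fun M : 'M_n.+2 => M 0 0) gX.
  rewrite !mxE !big_ord_recl !mxE /= !big1 => [|k _|k _];
    rewrite ?mxE /= ?mulr0 ?mul0r //.
  by rewrite (g_col0 ord0) mulr0 !addr0 [RHS]mulrC.
congr (_, _) => //.
have := congr1 (fun M : 'M_n.+2 => M 0 (lift ord0 0)) gX.
rewrite !mxE !big_ord_recl !mxE /= !big1 => [|k _|k _];
  rewrite ?mxE /= ?mulr0 ?mul0r //.
rewrite g11 !addr0 -lambdaE (mulrC lambda) [RHS]addrC => /addIr.
by rewrite [RHS]mulrC => /(mulfI g00) /addIr.
Qed.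

Theorem theorem9p4 (R : realType) (n : nat) (n_gt0 : (0 < n)%N) :
  (forall X Y : 'M[R[i]]_n, in_M (X, Y) ->
     exists lambda mu : R[i], conjugate (X, Y) (P n lambda mu))
  /\
  ((1 < n)%N ->
   forall lambda mu lambda' mu' : R[i], (lambda, mu) <> (lambda', mu') ->
     ~ conjugate (P n lambda mu) (P n lambda' mu')).
Proof.
split; last first.
  case: n {n_gt0} => [|[|n]] // _ la mu la' mu' neq /conjugate_P_inj.
  exact: neq.
case: n n_gt0 => // n _ X Y [/= XY rkY].
have {}XY : X * Y = Y * X + Y ^+ 2 by rewrite expr2 -mulmxE -XY addrC subrK.
have char0 := Num.Theory.pchar_num R[i].
have [la [mu [v [vYn vX]]]] := relation_cyclic_vector char0 XY rkY.
exists la, (mu + 1); apply: krylov_conjugate vX => //.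
exact: relation_nilpotent XY.
Qed.
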